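(* Let $\mathbf{x}^*$ be an optimal solution of problem (P) and let $\mathbf{y}^*$ be such that $(\mathbf{x}^*,\mathbf{y}^* )$ is a saddle point of (SP). Let $N\ge 1$ and let $(\mathbf{x}^k,\mathbf{y}^k)$, $k=1,\dots,N$, be generated by the decentralized primal-dual method with $$\alpha_k=\theta_k=1,\qquad \eta_k=2\|\mathbf{L}\|,\qquad \tau_k=\|\mathbf{L}\|,\qquad k=1,\dots,N.$$ Then $\bar{\mathbf{x}}^N:=\frac1N\sum_{k=1}^N\mathbf{x}^k$ satisfies $$F(\bar{\mathbf{x}}^N)-F(\mathbf{x}^* )\le \frac{\|\mathbf{L}\|}{N}\Big[2\mathbf{V}(\mathbf{x}^0,\mathbf{x}^* )+\tfrac12\|\mathbf{y}^0\|^2\Big]$$ and $$\|\mathbf{L}\bar{\mathbf{x}}^N\|\le \frac{2\|\mathbf{L}\|}{N}\Big[3\sqrt{\mathbf{V}(\mathbf{x}^0,\mathbf{x}^* )}+2\|\mathbf{y}^*-\mathbf{y}^0\|\Big].$$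
   Context: Setting. Let $m\ge 2$, $d\ge 1$, and let $\mathcal{G}=([m],\mathcal{E})$ be a connected undirected graph. Put $N_i=\{j:(i,j)\in\mathcal{E}\}\cup\{i\}$. The Laplacian $L\in\mathbb{R}^{m\times m}$ has $L_{ii}=|N_i|-1$, $L_{ij}=-1$ if $i\ne j$ and $(i,j)\in\mathcal{E}$, and $L_{ij}=0$ otherwise; $\mathbf{L}=L\otimes I_d$. For each $i\in[m]$, $X_i\subseteq\mathbb{R}^d$ is closed convex and $\bigcap_i X_i\neq\emptyset$; $\|\cdot\|_{X_i}$ is a norm on $\mathbb{R}^d$; $f_i:X_i\to\mathbb{R}$ is convex, with subgradients $f_i'(y)\in\partial f_i(y)$ satisfying $0\le f_i(x)-f_i(y)-\langle f_i'(y),x-y\rangle\le M\|x-y\|_{X_i}$ for all $x,y\in X_i$, for some $M\ge0$. Prox-functions. $\omega_i:X_i\to\mathbb{R}$ is continuously differentiable with $\langle\nabla\omega_i(x)-\nabla\omega_i(u),x-u\rangle\ge\|x-u\|_{X_i}^2$, and $V_i(x,u)=\omega_i(u)-\omega_i(x)-\langle\nabla\omega_i(x),u-x\rangle$. Write $X^m=X_1\times\dots\times X_m$, $\mathbf{x}=(x_1,\dots,x_m)$, $\|\mathbf{x}\|^2=\sum_i\|x_i\|_{X_i}^2$ for primal vectors, $\mathbf{V}(\mathbf{x},\mathbf{u})=\sum_iV_i(x_i,u_i)$. Dual vectors $\mathbf{y}\in\mathbb{R}^{md}$ and vectors $\mathbf{L}\mathbf{x}$ are measured in the Euclidean norm,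 and $\|\mathbf{L}\|$ is the operator norm from the primal norm to the Euclidean norm. Problem. (P): minimize $F(\mathbf{x})=\sum_{i=1}^mf_i(x_i)$ subject to $\mathbf{L}\mathbf{x}=\mathbf{0}$, $\mathbf{x}\in X^m$. (SP): $\min_{\mathbf{x}\in X^m}\big[F(\mathbf{x})+\max_{\mathbf{y}\in\mathbb{R}^{md}}\langle\mathbf{L}\mathbf{x},\mathbf{y}\rangle\big]$. It is assumed that there are an optimal solution $\mathbf{x}^*$ of (P) and $\mathbf{y}^*\in\mathbb{R}^{md}$ such that $(\mathbf{x}^*,\mathbf{y}^* )$ is a saddle point of (SP). Decentralized primal-dual method. Given $\mathbf{x}^0=\mathbf{x}^{-1}\in X^m$, $\mathbf{y}^0\in\mathbb{R}^{md}$ and parameters $\alpha_k,\tau_k,\eta_k$ and weights $\theta_k$, for $k=1,\dots,N$ set $\tilde{\mathbf{x}}^k=\alpha_k(\mathbf{x}^{k-1}-\mathbf{x}^{k-2})+\mathbf{x}^{k-1}$; $\mathbf{y}^k=\arg\min_{\mathbf{y}\in\mathbb{R}^{md}}\langle-\mathbf{L}\tilde{\mathbf{x}}^k,\mathbf{y}\rangle+\frac{\tau_k}{2}\|\mathbf{y}-\mathbf{y}^{k-1}\|^2$; $\mathbf{x}^k=\arg\min_{\mathbf{x}\in X^m}\langle\mathbf{L}\mathbf{y}^k,\mathbf{x}\rangle+F(\mathbf{x})+\eta_k\mathbf{V}(\mathbf{x}^{k-1},\mathbf{x})$. *)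

(* Defs.v *)
From HB Require Import structures.
From mathcomp Require Import all_boot all_order all_algebra.
From mathcomp Require Import mxtens.
From mathcomp Require Import all_classical all_reals all_analysis.

Set Implicit Arguments.
Unset Strict Implicit.
Unset Printing Implicit Defensive.

Import Order.TTheory GRing.Theory Num.Theory.
Import numFieldNormedType.Exports.

Local Open Scope classical_set_scope.
Local Open Scope ring_scope.

Section Euclidean.
Context {R : realType}.

Definition dot n (u v : 'cV[R]_n) : R := \sum_i u i 0 * v i 0.

Definition enorm n (u : 'cV[R]_n) : R := Num.sqrt (dot u u).

(* Nonnegativity and [p 0 = 0] follow from the first two clauses. *)
Definition is_norm n (p : 'cV[R]_n -> R) : Prop :=
  [/\ forall x y, p (x + y) <= p x + p y,
      forall (a : R) x, p (a *: x) = `|a| * p x &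
      forall x, p x = 0 -> x = 0].

Definition opnorm n q (p : 'cV[R]_n -> R) (A : 'M[R]_(q, n)) : R :=
  sup [set enorm (A *m x) | x in [set x | p x <= 1]].

Definition argmin (T : Type) (A : set T) (g : T -> R) : set T :=
  [set x | A x /\ forall u, A u -> g x <= g u].

Definition subdifferential n (A : set 'cV[R]_n) (f : 'cV[R]_n -> R)
    (y : 'cV[R]_n) : set 'cV[R]_n :=
  [set g | A y /\ forall x, A x -> f y + dot g (x - y) <= f x].

(* Differentiability is relative to [A], so that it makes sense at boundary
   points and when [A] has empty interior; in the latter case [g] is determined
   only up to the orthogonal of the directions of [A], which affects neither
   the Bregman distance on [A] nor the monotonicity of the gradient on [A]. *)
Definition gradient_within n (A : set 'cV[R]_n) (phi : 'cV[R]_n -> R)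
    (x g : 'cV[R]_n) : Prop :=
  forall e : R, 0 < e -> \forall u \near within A (nbhs x),
    `|phi u - phi x - dot g (u - x)| <= e * enorm (u - x).

Definition continuously_differentiable_on n (A : set 'cV[R]_n)
    (phi : 'cV[R]_n -> R) (grad : 'cV[R]_n -> 'cV[R]_n) : Prop :=
  (forall x, A x -> gradient_within A phi x (grad x)) /\
  {within A, continuous grad}.

Definition bregman n (omega : 'cV[R]_n -> R) (grad : 'cV[R]_n -> 'cV[R]_n)
    (x u : 'cV[R]_n) : R :=
  omega u - omega x - dot (grad x) (u - x).

End Euclidean.

Section Laplacian.
Context (R : realType) (m : nat).

Definition neighborhood (E : rel 'I_m) (i : 'I_m) : {set 'I_m} :=
  [set j | E i j] :|: [set i].

Definition laplacian (E : rel 'I_m) : 'M[R]_m :=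
  \matrix_(i, j) if i == j then #|neighborhood E i|%:R - 1
                 else if E i j then - 1 else 0.

Definition blaplacian (d : nat) (E : rel 'I_m) : 'M[R]_(m * d) :=
  laplacian E *t (1%:M : 'M[R]_d).

End Laplacian.

Section Blocks.
Context {R : realType} {m d : nat}.

(* [mxtens_index (i, k)] is the position of entry [(i, k)] in the index
   convention of the Kronecker product [_ *t _]. *)
Definition block (x : 'cV[R]_(m * d)) (i : 'I_m) : 'cV[R]_d :=
  \col_k x (mxtens_index (i, k)) 0.

Definition prodset (X : 'I_m -> set 'cV[R]_d) : set 'cV[R]_(m * d) :=
  [set x | forall i, X i (block x i)].

Definition primal_norm (p : 'I_m -> 'cV[R]_d -> R) (x : 'cV[R]_(m * d)) : R :=
  Num.sqrt (\sum_i p i (block x i) ^+ 2).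

Definition sumobj (f : 'I_m -> 'cV[R]_d -> R) (x : 'cV[R]_(m * d)) : R :=
  \sum_i f i (block x i).

Definition bregman_sum (omega : 'I_m -> 'cV[R]_d -> R)
    (grad : 'I_m -> 'cV[R]_d -> 'cV[R]_d) (x u : 'cV[R]_(m * d)) : R :=
  \sum_i bregman (omega i) (grad i) (block x i) (block u i).

End Blocks.

Section Problem.
Context {R : realType} {n : nat}.
Implicit Types (L : 'M[R]_n) (C : set 'cV[R]_n) (F : 'cV[R]_n -> R).

Definition optimal_P L C F (x : 'cV[R]_n) : Prop :=
  argmin [set x | L *m x = 0 /\ C x] F x.

Definition lagrangian L F (x y : 'cV[R]_n) : R := F x + dot (L *m x) y.

Definition saddle_SP L C F (xs ys : 'cV[R]_n) : Prop :=
  C xs /\ forall x y, C x ->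
    lagrangian L F xs y <= lagrangian L F xs ys <= lagrangian L F x ys.

(* [k.-2] is truncated: for [k = 1] it is [0], which encodes the
   initialization x^{-1} = x^0. *)
Definition primal_dual_iterates L C F (V : 'cV[R]_n -> 'cV[R]_n -> R)
    (alpha tau eta : nat -> R) (N : nat) (x y : nat -> 'cV[R]_n) : Prop :=
  C (x 0%N) /\
  forall k : nat, (1 <= k <= N)%N ->
    let xt := alpha k *: (x k.-1 - x k.-2) + x k.-1 in
    argmin setT
      (fun v => dot (- (L *m xt)) v + tau k / 2 * enorm (v - y k.-1) ^+ 2)
      (y k) /\
    argmin C
      (fun u => dot (L *m y k) u + F u + eta k * V (x k.-1) u)
      (x k).

End Problem.

(* Main.v *)
(* Write K for the operator norm of L and D_k for x^k - x^{k-1}. Comparing the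
   objective minimized at step k with its values on the segment towards xs
   (resp. v) gives the three-point inequalities for x^k and y^k. Since L is
   symmetric and L xs = 0, their sum shows that
     sum_{i <= k} (F(x^i) - F(xs) + <L x^i, v>) + 2 K V(x^k, xs)
       + K/2 |v - y^k|^2 + K V(x^{k-1}, x^k) - <L D_k, v - y^k>
   does not increase with k: the extrapolation makes the coupling terms
   telescope up to <L D_k, y^{k+1} - y^k>, which Cauchy-Schwarz and
   |.|^2 / 2 <= V absorb. Jensen's inequality then bounds the gap at xbar for
   every v. The choice v = 0 bounds the objective; v = ys + r u, with u the
   direction of L xbar, bounds the infeasibility by means of the saddle point
   inequality, for r = 2 sqrt(V(x^0, xs)) + |ys - y^0| (any r > 0, tending
   to 0, if this vanishes). *)
Require Import Defs.
From HB Require Import structures.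
From mathcomp Require Import all_boot all_order all_algebra.
From mathcomp Require Import mxtens.
From mathcomp Require Import all_classical all_reals all_analysis.
From mathcomp Require Import ring lra.

Import Order.TTheory GRing.Theory Num.Theory.
Import numFieldNormedType.Exports.

Local Open Scope classical_set_scope.
Local Open Scope ring_scope.

(** * Euclidean inner product and norm on column vectors *)

Section Euclidean.
Context {R : realType} {n : nat}.
Implicit Types (u v w : 'cV[R]_n) (a : R).

Lemma dotC u v : dot u v = dot v u.
Proof. by apply: eq_bigr => i _; rewrite mulrC. Qed.

Lemma dotDl u v w : dot (u + v) w = dot u w + dot v w.
Proof.
by rewrite /dot -big_split; apply: eq_bigr => i _; rewrite mxE mulrDl.
Qed.

Lemma dotZl a u v : dot (a *: u) v = a * dot u v.
Proof. by rewrite /dot mulr_sumr; apply: eq_bigr => i _; rewrite mxE mulrA. Qed.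

Lemma dotNl u v : dot (- u) v = - dot u v.
Proof. by rewrite -scaleN1r dotZl mulN1r. Qed.

Lemma dot0l v : dot 0 v = 0.
Proof. by rewrite -(scale0r 0) dotZl mul0r. Qed.

Lemma dotDr u v w : dot u (v + w) = dot u v + dot u w.
Proof. by rewrite ![dot u _]dotC dotDl. Qed.

Lemma dotZr a u v : dot u (a *: v) = a * dot u v.
Proof. by rewrite ![dot u _]dotC dotZl. Qed.

Lemma dotNr u v : dot u (- v) = - dot u v.
Proof. by rewrite ![dot u _]dotC dotNl. Qed.

Definition dotE := (dotDl, dotDr, dotNl, dotNr, dotZl, dotZr).

Lemma dot_ge0 u : 0 <= dot u u.
Proof. by apply: sumr_ge0 => i _; rewrite -expr2 sqr_ge0. Qed.

Lemma dot_eq0 u : dot u u = 0 -> u = 0.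
Proof.
move=> /eqP; rewrite psumr_eq0; last by move=> i _; rewrite -expr2 sqr_ge0.
move=> /allP u0; apply/colP => i; rewrite mxE; apply/eqP.
by have := u0 i (mem_index_enum i); rewrite mulf_eq0 orbb.
Qed.

Lemma enorm_ge0 u : 0 <= enorm u.
Proof. exact: sqrtr_ge0. Qed.

Lemma sqr_enorm u : enorm u ^+ 2 = dot u u.
Proof. by rewrite sqr_sqrtr ?dot_ge0. Qed.

Lemma enorm0 : enorm (0 : 'cV[R]_n) = 0.
Proof. by rewrite /enorm dot0l sqrtr0. Qed.

Lemma enormZ a u : enorm (a *: u) = `|a| * enorm u.
Proof. by rewrite /enorm !dotE mulrA -expr2 sqrtrM ?sqr_ge0// sqrtr_sqr. Qed.

Lemma enormN u : enorm (- u) = enorm u.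
Proof. by rewrite /enorm !dotE opprK. Qed.

(** Cauchy-Schwarz: for [u] nonzero, the squared norm of [dot u u *: v - dot u v *: u] equals
    [dot u u] times the Gram determinant of [u] and [v], which is therefore nonnegative. *)
Lemma dot_le_enormM u v : dot u v <= enorm u * enorm v.
Proof.
have [->|u0] := eqVneq u 0; first by rewrite dot0l enorm0 mul0r.
have duu0 : 0 < dot u u.
  by rewrite lt_def dot_ge0 andbT; apply: contra u0 => /eqP/dot_eq0 ->.
rewrite (le_trans (ler_norm _))// -sqrtr_sqr -sqrtrM ?dot_ge0// ler_wsqrtr//.
have := dot_ge0 (dot u u *: v - dot u v *: u).
rewrite !dotE (dotC v u); move: (dot u u) (dot v v) (dot u v) duu0 => a b c.
move=> a0 h; rewrite -subr_ge0 -(pmulr_rge0 _ a0); lra.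
Qed.

Lemma enormD u v : enorm (u + v) <= enorm u + enorm v.
Proof.
rewrite -(@ler_pXn2r _ 2) ?nnegrE ?addr_ge0 ?enorm_ge0// sqrrD !sqr_enorm.
rewrite !dotE (dotC v u); have := dot_le_enormM u v; lra.
Qed.

End Euclidean.

Lemma dot_mulmx {R : realType} {n q} (A : 'M[R]_(q, n)) (u : 'cV_n)
    (v : 'cV_q) :
  dot (A *m u) v = dot u (A^T *m v).
Proof.
have dE k (a b : 'cV[R]_k) : dot a b = (a^T *m b) 0 0.
  by rewrite mxE; apply: eq_bigr => i _; rewrite mxE.
by rewrite !dE trmx_mul mulmxA.
Qed.

(** * Equivalence of norms and the operator norm *)

Section OperatorNorm.
Context {R : realType}.

(** Expand [x] in the canonical basis. Asking only for a seminorm lets this apply to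
    [enorm (A *m x)] as well as to norms; the summand 1 in the constant makes it positive. *)
Lemma seminorm_le_mx_norm {n} {q : 'cV[R]_n -> R} :
  (forall x y, q (x + y) <= q x + q y) ->
  (forall a x, q (a *: x) = `|a| * q x) ->
  exists2 K, 0 < K & forall x, q x <= K * `|x|.
Proof.
move=> qD qZ.
have q0 : q 0 = 0 by rewrite -(scale0r 0) qZ normr0 mul0r.
have q_ge0 x : 0 <= q x.
  have := qD x (- x); rewrite subrr q0 -scaleN1r qZ normrN1 mul1r; lra.
exists (1 + \sum_i q (delta_mx i 0)); first by rewrite ltr_pwDl ?sumr_ge0.
move=> x; rewrite mulrDl mul1r ler_wpDl ?normr_ge0//.
have -> : q x = q (\sum_i x i 0 *: delta_mx i 0).
  congr q; rewrite [LHS]matrix_sum_delta; apply: eq_bigr => i _.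
  by rewrite big_ord1.
have : q (\sum_i x i 0 *: delta_mx i 0) <= \sum_i q (x i 0 *: delta_mx i 0).
  elim/big_ind2 : _ => [|a b c d ab cd|//]; first by rewrite q0.
  by rewrite (le_trans (qD _ _))// lerD.
move=> /le_trans; apply; rewrite mulr_suml; apply: ler_sum => i _.
rewrite qZ mulrC ler_wpM2l// [leRHS]/Num.norm/= mx_normrE.
by apply/bigmax_geP; right; exists (i, 0).
Qed.

(** The constant is the minimum of [p] over the unit sphere of the sup norm: attained by
    compactness, positive by definiteness, and extended to all vectors by homogeneity. The sphere
    consists of row vectors, the form in which compactness and the extreme value theorem are
    applied. *)
Lemma mx_norm_le_norm {n} {p : 'cV[R]_n -> R} : is_norm p ->
  exists2 c, 0 < c & forall x, c * `|x| <= p x.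
Proof.
move=> [pD pZ p_inj].
have p0 : p 0 = 0 by rewrite -(scale0r 0) pZ normr0 mul0r.
have pN x : p (- x) = p x by rewrite -scaleN1r pZ normrN1 mul1r.
have p_ge0 x : 0 <= p x.
  have := pD x (- x); rewrite subrr p0 pN; lra.
have [K K0 pK] := seminorm_le_mx_norm pD pZ.
have norm_tr (v : 'rV[R]_n) : `|v^T| = `|v|.
  rewrite /Num.norm/= !mx_normrE.
  rewrite (reindex (fun ij : 'I_1 * 'I_n => (ij.2, ij.1)))/=.
    by apply: eq_bigr => ij _; rewrite mxE.
  by exists (fun ij => (ij.2, ij.1)) => -[].
pose S := [set v : 'rV[R]_n | `|v| = 1].
have pS : {within S, continuous (fun v : 'rV[R]_n => p v^T)}.
  apply: continuous_subspaceT => v.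
  apply/(@cvgrPdist_le _ _ _ (nbhs v) (nbhs_filter v)) => e e0.
  near=> w.
  have vw : p (v^T - w^T) <= e.
    rewrite (le_trans (pK _))// mulrC -ler_pdivlMr// -linearB/= norm_tr.
    near: w; apply/nbhs_ballP; exists (e / K); first by rewrite /= divr_gt0.
    by move=> w; rewrite mx_norm_ball /ball_/= => /ltW.
  rewrite ler_norml; apply/andP; split.
    have := pD w^T (- (w^T - v^T)); rewrite pN opprB [w^T + _]addrC subrK.
    have := pD v^T (w^T - v^T); rewrite addrC subrK -[w^T - _]opprB pN. lra.
  have := pD w^T (v^T - w^T); rewrite [w^T + _]addrC subrK; lra.
have cS : compact S.
  apply: bounded_closed_compact.
    exists 1; split; first exact: num_real.
    by move=> M M1 v /= ->; exact: ltW.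
  rewrite (_ : S = (fun v => `|v|) @^-1` [set 1])//.
  by apply: closed_comp => [v _|]; [exact: norm_continuous | exact: closed_eq].
(* An empty sphere means that 0 is the only vector, and then any constant works. *)
have [[v Sv]|S0] := pselect (S !=set0); last first.
  exists 1 => // x.
  have [->|x0] := eqVneq x 0; first by rewrite normr0 mulr0 p0.
  exfalso; apply: S0; exists (`|x|^-1 *: x^T); rewrite /S/=.
  by rewrite normrZ -norm_tr trmxK normfV normr_id mulVf ?normr_eq0.
have [c /set_mem Sc cmin] := EVT_min_rV (ex_intro _ v Sv) cS pS.
exists (p c^T).
  rewrite lt_def p_ge0 andbT; apply/eqP => /p_inj /(congr1 Num.norm).
  by rewrite norm_tr Sc normr0 => /eqP; rewrite oner_eq0.
move=> x; have [->|x0] := eqVneq x 0; first by rewrite normr0 mulr0 p0.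
have nx0 : 0 < `|x| by rewrite normr_gt0.
have /cmin : `|x|^-1 *: x^T \in S.
  by rewrite inE /S/= normrZ -norm_tr trmxK normfV normr_id mulVf ?normr_eq0.
by rewrite linearZ/= trmxK pZ normfV normr_id -ler_pdivlMr// [p x / _]mulrC.
Unshelve. all: end_near. Qed.

(** Both [p] and [enorm (A *m x)] compare with the sup norm, so the supremum is over a bounded set;
    normalizing [x] to [p]-norm 1 gives the inequality. *)
Lemma enorm_mulmx_le_opnorm {n q} {p : 'cV[R]_n -> R} (A : 'M[R]_(q, n)) :
  is_norm p ->
  0 <= opnorm p A /\ forall x, enorm (A *m x) <= opnorm p A * p x.
Proof.
move=> hp; have [c c0 cp] := mx_norm_le_norm hp; case: hp => [pD pZ p_inj].
have p0 : p 0 = 0 by rewrite -(scale0r 0) pZ normr0 mul0r.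
have [| |K K0 AK] := @seminorm_le_mx_norm n (fun x => enorm (A *m x)).
- by move=> x y; rewrite mulmxDr enormD.
- by move=> a x; rewrite -scalemxAr enormZ.
(* boundedness matters: the supremum of an unbounded set is 0 *)
have sup_le x : p x <= 1 -> enorm (A *m x) <= opnorm p A.
  move=> px; apply: ub_le_sup; last by exists x.
  exists (K / c) => _ [y /= py <-]; rewrite (le_trans (AK _))// ler_pM2l//.
  by rewrite -[leRHS]mul1r ler_pdivlMr// mulrC (le_trans (cp _)).
split.
  by have := @sup_le 0; rewrite p0 mulmx0 enorm0; apply; exact: ler01.
move=> x; have [->|x0] := eqVneq x 0; first by rewrite mulmx0 enorm0 p0 mulr0.
have px0 : 0 < p x.
  by rewrite (lt_le_trans _ (cp x))// mulr_gt0// normr_gt0.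
have := sup_le ((p x)^-1 *: x).
rewrite pZ -scalemxAr enormZ normfV gtr0_norm// mulVf ?gt_eqF// lexx.
move=> /(_ isT).
by rewrite mulrC ler_pdivrMr.
Qed.

End OperatorNorm.

(** * Convexity along segments and Jensen's inequality for a mean *)

Section Convexity.
Context {R : realType} {n : nat}.
Implicit Types (C : set 'cV[R]_n) (F : 'cV[R]_n -> R) (x u : 'cV[R]_n).

Lemma conv_segment (t : {i01 R}) x u :
  conv t (u : convex_lmodType 'cV[R]_n) x = x + t%:num *: (u - x).
Proof.
by rewrite /conv/= scalerBl scale1r scalerBr addrCA.
Qed.

Lemma convex_set_segment C x u (t : R) : convex_set C -> C x -> C u ->
  0 <= t <= 1 -> C (x + t *: (u - x)).
Proof.
move=> cC Cx Cu /andP[t0 t1].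
have := cC u x (Itv01 t0 t1) (mem_set Cu) (mem_set Cx).
by rewrite conv_segment inE.
Qed.

Lemma convex_function_segment C F x u (t : R) : convex_function C F ->
  C x -> C u -> 0 <= t <= 1 -> F (x + t *: (u - x)) <= F x + t * (F u - F x).
Proof.
move=> cF Cx Cu /andP[t0 t1].
have := cF (Itv01 t0 t1) u x (mem_set Cu) (mem_set Cx).
rewrite conv_segment convRE/= /unstable.onem => /le_trans; apply; lra.
Qed.

(** Induction: if [z] is the mean of the first N+1 points, the mean of N+2 points lies on the
    segment from [z] to the new point, at parameter 1/(N+2). *)
Lemma convex_mean C F (x : nat -> 'cV[R]_n) (N : nat) :
  convex_set C -> convex_function C F -> (0 < N)%N ->
  (forall k, (1 <= k <= N)%N -> C (x k)) ->
  C (N%:R^-1 *: \sum_(1 <= k < N.+1) x k) /\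
  N%:R * F (N%:R^-1 *: \sum_(1 <= k < N.+1) x k) <=
  \sum_(1 <= k < N.+1) F (x k).
Proof.
move=> cC cF; elim: N => // -[_ _ Cx|N IH _ Cx].
  by rewrite !big_nat1 invr1 scale1r mul1r; split => //; exact: Cx.
have [|Cz Fz] := IH isT.
  by move=> k /andP[k1 kN]; apply: Cx; rewrite k1 (leq_trans kN).
rewrite (big_nat_recr N.+2 _ x)//= (big_nat_recr N.+2 _ (F \o x))//=.
set z := _ *: _ in Cz Fz.
have N2 : N.+2%:R != 0 :> R by rewrite pnatr_eq0.
have N1 : N.+1%:R != 0 :> R by rewrite pnatr_eq0.
have -> : \sum_(1 <= k < N.+2) x k = N.+1%:R *: z.
  by rewrite scalerA mulfV// scale1r.
have -> : N.+2%:R^-1 *: (N.+1%:R *: z + x N.+2) =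
    z + N.+2%:R^-1 *: (x N.+2 - z).
  clearbody z.
  apply: (scalerI N2).
  rewrite [RHS]scalerDr !(scalerA N.+2%:R) mulfV// !scale1r.
  by rewrite -[N.+2%:R]natr1 scalerDl scale1r -addrA [z + _]addrC subrK.
have CxN : C (x N.+2) by apply: Cx; rewrite ltnS leqnn.
have t01 : 0 <= (N.+2%:R^-1 : R) <= 1.
  by rewrite invr_ge0 ler0n/= invf_le1 ?ltr0n// ler1n.
split; first exact: convex_set_segment.
have := convex_function_segment C F z (x N.+2) _ cF Cz CxN t01.
rewrite -(ler_pM2l (ltr0Sn R N.+1)) => /le_trans; apply.
rewrite mulrDr mulrA mulfV// mul1r -natr1 mulrDl mul1r.
by move: Fz; lra.
Qed.

End Convexity.

(** * Strong convexity of a prox-function from monotonicity of its gradient *)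

Section Bregman.
Context {R : realType} {n : nat} (C : set 'cV[R]_n).
Hypothesis cC : convex_set C.
Context (Om : 'cV[R]_n -> R).

(** The chain rule along a segment, one-sided at its ends because differentiability is only relative
    to [C]. *)
Lemma gradient_within_segment (x u g : 'cV[R]_n) (s : R) :
  C x -> C u -> gradient_within C Om (x + s *: (u - x)) g ->
  forall e : R, 0 < e -> \forall t \near within `[0, 1] (nbhs s),
    `|Om (x + t *: (u - x)) - Om (x + s *: (u - x)) - (t - s) * dot g (u - x)|
      <= e * `|t - s|.
Proof.
move=> Cx Cu dOm e e0; set h := u - x.
(* The tolerance is divided by [enorm h + 1], not by [enorm h], which vanishes when [u = x]. *)
have k0 : 0 < enorm h + 1 by rewrite ltr_wpDl ?enorm_ge0.
have := dOm (e / (enorm h + 1)) (divr_gt0 e0 k0).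
have cl : (fun t : R => x + t *: h) @ s --> x + s *: h.
  by apply: cvgD; [exact: cvg_cst | apply: cvgZl; exact: cvg_id].
move=> /cl; rewrite !near_simpl => H.
rewrite near_withinE; near=> t => /itvP t01.
have Ct : C (x + t *: h) by apply: convex_set_segment; rewrite ?t01.
have : C (x + t *: h) -> `|Om (x + t *: h) - Om (x + s *: h) -
    dot g (x + t *: h - (x + s *: h))| <=
    e / (enorm h + 1) * enorm (x + t *: h - (x + s *: h)) by near: t.
move=> /(_ Ct); rewrite opprD addrACA subrr add0r -scalerBl dotZr enormZ.
move=> /le_trans; apply; rewrite mulrCA mulrC ler_wpM2r// ?normr_ge0//.
rewrite mulrAC ler_pdivrMr// ler_wpM2l ?ltW//; lra.
Unshelve. all: end_near. Qed.

Context (G : 'cV[R]_n -> 'cV[R]_n) (p : 'cV[R]_n -> R).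

(** Mean value theorem for [psi], which is [Om] on the segment minus its linear part at [x] and the
    quadratic to be beaten: [psi 1 - psi 0] is the difference of the two sides, and monotonicity
    between [l c] and [x] makes the derivative at [c] nonnegative. *)
Lemma bregman_strongly_convex (x u : 'cV[R]_n) : C x -> C u ->
  (forall y, C y -> gradient_within C Om y (G y)) ->
  (forall y z, C y -> C z -> p (y - z) ^+ 2 <= dot (G y - G z) (y - z)) ->
  (forall a y, p (a *: y) = `|a| * p y) ->
  p (u - x) ^+ 2 / 2 <= bregman Om G x u.
Proof.
move=> Cx Cu dOm mono pZ; set h := u - x.
pose l (t : R) := x + t *: h.
have Cl (t : R) : 0 <= t <= 1 -> C (l t) by move=> ?; exact: convex_set_segment.
have near_l (t : R) : 0 <= t <= 1 -> forall e : R, 0 < e ->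
    \forall r \near within `[0, 1] (nbhs t),
    `|Om (l r) - Om (l t) - (r - t) * dot (G (l t)) h| <= e * `|r - t|.
  by move=> t01; apply: gradient_within_segment => //; apply/dOm/Cl.
(* At an interior parameter [[0, 1]] is a neighbourhood, so the relative expansion gives a two-sided
   derivative. *)
have dl (t : R) : t \in `]0, 1[%R -> is_derive t 1 (Om \o l) (dot (G (l t)) h).
  move=> t01.
  have t01' : 0 <= t <= 1 by rewrite !ltW ?(itvP t01).
  have lim : (fun r => r^-1 *: ((Om \o l) (r *: 1 + t) - (Om \o l) t)) @ 0^' -->
      dot (G (l t)) h.
    apply/cvgrPdist_le => e e0.
    have /(_ e e0) := near_l t t01'.
    rewrite near_withinE => H.
    have H' : \forall r \near t,
        `|Om (l r) - Om (l t) - (r - t) * dot (G (l t)) h| <= e * `|r - t|.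
      near=> r; have : (`[0, 1]%classic : set R) r -> `|Om (l r) - Om (l t) -
        (r - t) * dot (G (l t)) h| <= e * `|r - t| by near: r.
      apply; apply: subset_itv_oo_cc; near: r; exact: near_in_itvoo.
    have H0 : (fun r : R => r *: 1 + t) @ 0 --> t.
      rewrite -[X in _ --> X]add0r -[X in X + t](scale0r 1).
      by apply: cvgD; [apply: cvgZl; exact: cvg_id|exact: cvg_cst].
    have := H0 _ H'; rewrite near_simpl => /nbhs_dnbhs H1.
    near=> r.
    have r0 : r != 0 by near: r; exact: nbhs_dnbhs_neq.
    have : `|Om (l (r *: 1 + t)) - Om (l t) -
      (r *: 1 + t - t) * dot (G (l t)) h| <= e * `|r *: 1 + t - t| by near: r.
    rewrite addrK [r *: 1]mulr1 => Hr.
    rewrite distrC.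
    suff : `|r^-1 * (Om (l (r + t)) - Om (l t) - r * dot (G (l t)) h)| <= e.
      by rewrite mulrBr mulKf.
    rewrite normrM normfV.
    by rewrite ler_pdivrMl ?normr_gt0// (mulrC `|r|).
  have dv : derivable (Om \o l) t 1 by apply/cvg_ex; exists (dot (G (l t)) h).
  by split => //; apply: cvg_lim.
pose psi (t : R) := Om (l t) - t * dot (G x) h - t ^+ 2 / 2 * p h ^+ 2.
have dpsi (t : R) : t \in `]0, 1[%R -> is_derive t 1 psi
    (dot (G (l t)) h - dot (G x) h - t * p h ^+ 2).
  move=> /dl dlt.
  have -> : psi = (Om \o l) - (cst (dot (G x) h) : R -> R) * (@id R) -
      (cst (p h ^+ 2 / 2) : R -> R) * (@id R ^+ 2).
    by apply/funext => r; rewrite /psi !fctE; ring.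
  apply: is_derive_eq; rewrite /GRing.scale/= !mulr0 !addr0 !mulr1 expr1.
  lra.
(* The first-order expansion with tolerance 1 gives a local Lipschitz bound with constant [D], valid
   at the endpoints too. *)
have cl : {within `[0, 1], continuous (Om \o l)}.
  apply/subspace_continuousP => t t01; apply/cvgrPdist_le => e e0.
  have /(_ 1 ltr01) near_t := near_l t t01.
  pose D := `|dot (G (l t)) h| + 1.
  have D0 : 0 < D by rewrite ltr_wpDl.
  near=> r.
  have : `|Om (l r) - Om (l t) - (r - t) * dot (G (l t)) h| <= 1 * `|r - t|.
    by near: r.
  rewrite mul1r => H.
  have rt : `|t - r| <= e / D.
    near: r; apply: cvg_within.
    apply: (@cvgr_dist_le _ _ _ (nbhs t) _ id t); first exact: cvg_id.
    exact: divr_gt0.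
  rewrite distrC /= -(subrK ((r - t) * dot (G (l t)) h) (Om (l r) - Om (l t))).
  rewrite (le_trans (ler_normD _ _))// normrM.
  rewrite ler_pdivlMr// /D mulrDr mulr1 distrC in rt.
  lra.
have cpsi : {within `[0, 1], continuous psi}.
  move/subspace_continuousP: cl => cl.
  apply/subspace_continuousP => t t01; apply: cvgB; first apply: cvgB.
  - exact: cl.
  - by apply: cvgM; [exact: cvg_within|exact: cvg_cst].
  - apply: cvgM; last exact: cvg_cst.
    apply: cvgM; last exact: cvg_cst.
    rewrite expr2; under eq_fun do rewrite expr2.
    by apply: cvgM; exact: cvg_within.
have [c c01 E] := MVT ltr01 dpsi cpsi.
have c0 : 0 < c by rewrite (itvP c01).
have : 0 <= psi 1 - psi 0.
  (* Multiplying by [c] matches the monotonicity inequality, whose increment [l c - x] is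
     [c *: h]. *)
  rewrite E subr0 mulr1 -(pmulr_rge0 _ c0).
  have Cc : C (l c) by apply: Cl; rewrite !ltW ?(itvP c01).
  have := mono _ _ Cc Cx.
  rewrite /l [x + _]addrC addrK pZ gtr0_norm// exprMn dotZr !dotE; lra.
rewrite /psi /l scale0r scale1r addr0 [x + h]addrC subrK /bregman -/h.
rewrite expr1n expr0n/=; lra.
Unshelve. all: end_near. Qed.
End Bregman.

(** * Three-point inequalities for proximal steps *)

Section ThreePoint.
Context {R : realType} {n : nat}.
Implicit Types (C : set 'cV[R]_n) (F Om : 'cV[R]_n -> R).

Lemma bregman_three_point Om (G : 'cV[R]_n -> 'cV[R]_n) x0 x1 u :
  bregman Om G x0 u - bregman Om G x1 u - bregman Om G x0 x1 =
  dot (G x1 - G x0) (u - x1).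
Proof. by rewrite /bregman !dotE; ring. Qed.

(** First-order optimality: compare the objective at [x1] with its value at [x1 + t *: (u - x1)],
    use convexity of [F] and the expansion of [Om], and divide by a small [t > 0]. The identity
    [bregman_three_point] turns the resulting gradient term into Bregman distances. *)
Lemma argmin_three_point C F Om (G : 'cV[R]_n -> 'cV[R]_n) q eta x0 x1 u :
  convex_set C -> convex_function C F -> 0 <= eta ->
  gradient_within C Om x1 (G x1) ->
  argmin C (fun v => dot q v + F v + eta * bregman Om G x0 v) x1 -> C u ->
  dot q (x1 - u) + F x1 - F u <=
  eta * (bregman Om G x0 u - bregman Om G x1 u - bregman Om G x0 x1).
Proof.
move=> cC cF eta0 dOm [Cx1 x1min] Cu.
rewrite bregman_three_point -(opprB u x1) dotNr; set h := u - x1.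
apply/ler_addgt0Pr => e e0.
have k0 : 0 < eta + 1 by lra.
(* After multiplication by [eta] this tolerance stays below [e], also for [eta = 0]. *)
have e'0 : 0 < e / (eta + 1) by rewrite divr_gt0.
have := @gradient_within_segment _ _ C cC Om x1 u (G x1) 0 Cx1 Cu.
rewrite scale0r addr0 => /(_ dOm _ e'0); rewrite near_withinE => H.
have /cvg_within H' : \forall t \near nbhs (0 : R),
  (`[0, 1]%classic : set R) t ->
    `|Om (x1 + t *: h) - Om x1 - (t - 0) * dot (G x1) h| <=
      e / (eta + 1) * `|t - 0| := H.
near (0 : R)^'+ => t.
have t0 : 0 < t by near: t; exact: nbhs_right_gt.
have t1 : t <= 1 by near: t; exact: nbhs_right_le.
have t01 : 0 <= t <= 1 by rewrite ltW.
have : (`[0, 1]%classic : set R) t ->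
    `|Om (x1 + t *: h) - Om x1 - (t - 0) * dot (G x1) h| <=
      e / (eta + 1) * `|t - 0| by near: t; exact: H'.
rewrite /= in_itv/= => /(_ t01).
rewrite subr0 (gtr0_norm t0) => /(le_trans (ler_norm _)) Ht.
have Ft := convex_function_segment C F x1 u t cF Cx1 Cu t01.
have := x1min _ (convex_set_segment C x1 u t cC Cx1 Cu t01).
rewrite -/h in Ft *; rewrite /bregman [x1 + _ - x0]addrAC !dotE => xt.
have /(ler_wpM2l eta0) : Om (x1 + t *: h) - Om x1 <=
  t * (dot (G x1) h + e / (eta + 1)) by lra.
have : t * (eta * (e / (eta + 1))) <= t * e.
  by rewrite ler_pM2l// mulrCA ger_pMr// ler_pdivrMr//; lra.
move: (e / _) xt Ft => e' xt Ft te eta_le; rewrite -(ler_pM2l t0).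
rewrite /h !dotE -/h in eta_le; lra.
Unshelve. all: end_near. Qed.

(** The remainder is exactly half of [enorm (u - x) ^+ 2]; [K] converts the sup-norm ball into a
    Euclidean bound. *)
Lemma gradient_within_half_sqr C x :
  gradient_within C (fun v => enorm v ^+ 2 / 2) x x.
Proof.
move=> e e0; have [K K0 EK] := seminorm_le_mx_norm (@enormD R n) (@enormZ R n).
apply: cvg_within; apply/nbhs_ballP.
exists (e / K); first by rewrite /= divr_gt0.
move=> u; rewrite mx_norm_ball /ball_/= => /ltW.
rewrite ler_pdivlMr// distrC => ux.
have -> : enorm u ^+ 2 / 2 - enorm x ^+ 2 / 2 - dot x (u - x) =
  enorm (u - x) ^+ 2 / 2.
  by rewrite !sqr_enorm !dotE (dotC u x); field.
have := EK (u - x); have := enorm_ge0 (u - x); have := sqr_ge0 (enorm (u - x)).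
rewrite ger0_norm ?divr_ge0 ?sqr_ge0//; nra.
Qed.

Lemma bregman_half_sqr (x u : 'cV[R]_n) :
  bregman (fun v => enorm v ^+ 2 / 2) id x u = enorm (u - x) ^+ 2 / 2.
Proof. by rewrite /bregman !sqr_enorm !dotE (dotC u x); field. Qed.

End ThreePoint.

(** The Euclidean step is the case [F = 0] of [argmin_three_point], with half the squared norm as
    prox-function. *)
Lemma proximal_step_three_point {R : realType} {n : nat} (tau : R)
    (q y0 y1 y : 'cV[R]_n) : 0 <= tau ->
  argmin setT (fun v => dot q v + tau / 2 * enorm (v - y0) ^+ 2) y1 ->
  dot q (y1 - y) <=
  tau / 2 * (enorm (y - y0) ^+ 2 - enorm (y - y1) ^+ 2 - enorm (y1 - y0) ^+ 2).
Proof.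
move=> tau0 [_ y1min].
have cT : convex_set (setT : set 'cV[R]_n) by move=> *; rewrite inE.
have c0 : convex_function (setT : set 'cV[R]_n) (fun=> 0).
  by move=> t u v _ _ /=; rewrite convRE !mulr0 addr0.
have y1min' : argmin setT (fun v => dot q v + 0 +
    tau * bregman (fun v => enorm v ^+ 2 / 2) id y0 v) y1.
  by split => // v _; have := y1min v I; rewrite !bregman_half_sqr; lra.
have := argmin_three_point setT (fun=> 0) _ id q tau y0 y1 y cT c0 tau0
  (gradient_within_half_sqr setT y1) y1min' I.
rewrite !bregman_half_sqr; lra.
Qed.

(** * Convergence of the primal-dual method for one abstract prox-function *)

Section PrimalDual.
Context {R : realType} {n : nat}.
Context (L : 'M[R]_n) (C : set 'cV[R]_n) (F Om : 'cV[R]_n -> R).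
Context (G : 'cV[R]_n -> 'cV[R]_n) (p : 'cV[R]_n -> R) (K : R).
Hypothesis L_sym : L^T = L.
Hypothesis C_convex : convex_set C.
Hypothesis F_convex : convex_function C F.
Hypothesis Om_grad : forall u, C u -> gradient_within C Om u (G u).
Hypothesis p_bregman : forall u v, C u -> C v ->
  p (v - u) ^+ 2 / 2 <= bregman Om G u v.
Hypothesis K_ge0 : 0 <= K.
Hypothesis L_bounded : forall v, enorm (L *m v) <= K * p v.

Let V := bregman Om G.

Lemma bregman_ge0 u v : C u -> C v -> 0 <= V u v.
Proof.
move=> Cu Cv; apply: le_trans (p_bregman _ _ Cu Cv).
by rewrite divr_ge0 ?sqr_ge0.
Qed.

(** Cauchy-Schwarz, then Young's inequality with equal weights, then strong convexity of [Om]. *)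
Lemma dot_mulmx_le u v w : C u -> C v ->
  dot (L *m (v - u)) w <= K * V u v + K / 2 * enorm w ^+ 2.
Proof.
move=> Cu Cv; have := dot_le_enormM (L *m (v - u)) w.
have := ler_wpM2r (enorm_ge0 w) (L_bounded (v - u)).
have := ler_wpM2l K_ge0 (p_bregman _ _ Cu Cv).
have := mulr_ge0 K_ge0 (sqr_ge0 (p (v - u) - enorm w)).
rewrite -/V; move: (p _) (enorm w) => a b; lra.
Qed.

Context (N : nat) (x y : nat -> 'cV[R]_n) (alpha tau eta : nat -> R).
Hypothesis alpha1 : forall k, (1 <= k <= N)%N -> alpha k = 1.
Hypothesis tauK : forall k, (1 <= k <= N)%N -> tau k = K.
Hypothesis eta2K : forall k, (1 <= k <= N)%N -> eta k = 2 * K.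
Hypothesis xy_iter : primal_dual_iterates L C F V alpha tau eta N x y.

Lemma iterate_in k : (k <= N)%N -> C (x k).
Proof.
case: k => [_|k kN]; first by case: xy_iter.
by have [_ /(_ k.+1)] := xy_iter; rewrite kN => /(_ isT)[_ []].
Qed.

Lemma primal_dual_potential xs v k : C xs -> L *m xs = 0 -> (k <= N)%N ->
  \sum_(1 <= i < k.+1) (F (x i) - F xs + dot (L *m x i) v) +
  2 * K * V (x k) xs + K / 2 * enorm (v - y k) ^+ 2 +
  K * V (x k.-1) (x k) - dot (L *m (x k - x k.-1)) (v - y k) <=
  K * (2 * V (x 0%N) xs + 2^-1 * enorm (v - y 0%N) ^+ 2).
Proof.
move=> Cxs Lxs; elim: k => [_|k IH kN].
  (* At [k = 0] the truncated predecessor is 0 itself, so the coupling term and the distance from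
     [x k.-1] to [x k] vanish. *)
  rewrite big_geq//= subrr mulmx0 dot0l /V /bregman !subrr.
  by rewrite [dot _ 0]dotC dot0l; lra.
have {}IH := IH (ltnW kN).
have k1N : (1 <= k.+1 <= N)%N by [].
have [_ /(_ _ k1N)] := xy_iter.
rewrite alpha1// tauK// eta2K// scale1r; set xt := _ + _ => -[ymin xmin].
have Cx1 := iterate_in k.+1 kN.
have Cx0 := iterate_in k (ltnW kN).
have Cx' := iterate_in k.-1 (leq_trans (leq_pred k) (ltnW kN)).
have K2 : 0 <= 2 * K by rewrite mulr_ge0.
have hx := argmin_three_point C F Om G (L *m y k.+1) (2 * K) (x k) (x k.+1) xs
  C_convex F_convex K2 (Om_grad _ Cx1) xmin Cxs.
have hy := proximal_step_three_point K _ _ _ v K_ge0 ymin.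
(* This is paid for by the [K * V (x k.-1) (x k)] stored in the potential and by the dual term left
   over in [hy]. Of the [2 * K] copies of [V (x k) (x k.+1)] gained in [hx], [K] are stored for the
   next step and [K] are dropped. *)
have cross := dot_mulmx_le (x k.-1) (x k) (y k.+1 - y k) Cx' Cx0.
rewrite big_nat_recr//=.
rewrite dot_mulmx L_sym mulmxBr Lxs subr0 dotC -/V in hx.
rewrite /xt !mulmxDr !mulmxN !dotE in hy.
rewrite !mulmxDr !mulmxN !dotE in cross IH *.
have := mulr_ge0 K_ge0 (bregman_ge0 _ _ Cx0 Cx1).
lra.
Qed.

(** The last coupling term of the potential at [N] is absorbed by the two quadratic terms next to
    it; the remaining distance to [xs] is nonnegative. *)
Lemma primal_dual_ergodic xs v : C xs -> L *m xs = 0 ->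
  \sum_(1 <= k < N.+1) (F (x k) - F xs + dot (L *m x k) v) <=
  K * (2 * V (x 0%N) xs + 2^-1 * enorm (v - y 0%N) ^+ 2).
Proof.
move=> Cxs Lxs; have := primal_dual_potential xs v N Cxs Lxs (leqnn N).
have CxN := iterate_in N (leqnn N).
have CxN' := iterate_in N.-1 (leq_pred N).
have := dot_mulmx_le (x N.-1) (x N) (v - y N) CxN' CxN.
have := mulr_ge0 K_ge0 (bregman_ge0 (x N) xs CxN Cxs).
lra.
Qed.

Let xbar := N%:R^-1 *: \sum_(1 <= k < N.+1) x k.

Lemma primal_dual_average xs v : (0 < N)%N -> C xs -> L *m xs = 0 ->
  C xbar /\
  N%:R * (F xbar - F xs + dot (L *m xbar) v) <=
  K * (2 * V (x 0%N) xs + 2^-1 * enorm (v - y 0%N) ^+ 2).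
Proof.
move=> N0 Cxs Lxs.
have [|Cxbar Fxbar] := convex_mean C F x N C_convex F_convex N0.
  by move=> k /andP[_ kN]; exact: iterate_in.
split => //; apply: le_trans (primal_dual_ergodic xs v Cxs Lxs).
rewrite big_split/= big_split/= sumr_const_nat subn1/=.
have -> : \sum_(1 <= k < N.+1) dot (L *m x k) v = N%:R * dot (L *m xbar) v.
  rewrite -dotZl -scalemxAr scalerA mulfV ?scale1r ?pnatr_eq0 -?lt0n//.
  rewrite mulmx_sumr.
  by elim/big_rec2: _ => [|k a b _ ->]; rewrite ?dot0l ?dotDl.
rewrite -/xbar in Fxbar; rewrite -mulr_natl; lra.
Qed.

Lemma primal_dual_rate xs ys : (0 < N)%N -> saddle_SP L C F xs ys ->
  L *m xs = 0 ->
  F xbar - F xs <=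
    K / N%:R * (2 * V (x 0%N) xs + 2^-1 * enorm (y 0%N) ^+ 2) /\
  enorm (L *m xbar) <=
    2 * K / N%:R * (3 * Num.sqrt (V (x 0%N) xs) + 2 * enorm (ys - y 0%N)).
Proof.
move=> N0 [Cxs saddle] Lxs; have NR0 : 0 < N%:R :> R by rewrite ltr0n.
split.
  have [_] := primal_dual_average xs 0 N0 Cxs Lxs.
  rewrite sub0r enormN dotC dot0l addr0 => H.
  by rewrite mulrAC ler_pdivlMr// mulrC.
have [Cxbar _] := primal_dual_average xs 0 N0 Cxs Lxs.
have Cx0 := iterate_in 0 (leq0n N).
have V0 := bregman_ge0 (x 0%N) xs Cx0 Cxs.
(* Only the primal half of the saddle inequality is kept, [F xs <= F xbar + dot (L *m xbar) ys]; the
   dual argument 0 is arbitrary. *)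
have /andP[_] := saddle xbar 0 Cxbar.
rewrite /lagrangian Lxs dot0l addr0 => sad.
rewrite mulrAC ler_pdivlMr// mulrC.
set l := enorm _; set s := Num.sqrt _; set D := enorm _.
have l0 : 0 <= l := enorm_ge0 _.
have s0 : 0 <= s := sqrtr_ge0 _.
have D0 : 0 <= D := enorm_ge0 _.
have s2 : V (x 0%N) xs = s ^+ 2 by rewrite sqr_sqrtr.
(* the multiplier [ys + t L xbar] makes the gap dominate [t |L xbar|^2] *)
have key (t : R) : 0 <= t ->
    N%:R * (t * l) * l <= K * (2 * s ^+ 2 + 2^-1 * (D + t * l) ^+ 2).
  move=> t0.
  have [_] := primal_dual_average xs (ys + t *: (L *m xbar)) N0 Cxs Lxs.
  rewrite !dotE -sqr_enorm -/l s2 => H.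
  have : N%:R * (t * l) * l <= N%:R *
      (F xbar - F xs + (dot (L *m xbar) ys + t * l ^+ 2)).
    by rewrite -mulrA ler_pM2l//; lra.
  move=> /le_trans; apply; apply: (le_trans H).
  apply: ler_wpM2l => //; rewrite lerD2l ler_pM2l//.
  rewrite ler_pXn2r ?nnegrE ?enorm_ge0 ?addr_ge0 ?mulr_ge0//.
  rewrite addrAC (le_trans (enormD _ _))// enormZ ger0_norm//.
have [->|lneq0] := eqVneq l 0.
  by rewrite mulr0 !(mulr_ge0, addr_ge0).
have lp : 0 < l by rewrite lt_def lneq0.
(* Here [r] is the length of the shift [t *: (L *m xbar)]. *)
have keyr (r : R) : 0 <= r ->
    N%:R * r * l <= K * (2 * s ^+ 2 + 2^-1 * (D + r) ^+ 2).
  move=> r0; have := key (r / l); rewrite divfK//; apply; exact: divr_ge0.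
have [sD|sD] := ltP 0 (2 * s + D).
  have := keyr _ (ltW sD).
  (* With [r = 2 * s + D] the left side is [4 s^2 + 4 s D + 2 D^2]; factoring out [r] leaves twice
     the [3 * s + 2 * D] of the claim. *)
  have : 2 * s ^+ 2 + 2^-1 * (D + (2 * s + D)) ^+ 2 <=
      (2 * s + D) * (6 * s + 4 * D).
    have := mulr_ge0 s0 D0; have := sqr_ge0 s; have := sqr_ge0 D; lra.
  move=> /(ler_wpM2l K_ge0) H /le_trans /(_ H) {}H.
  by rewrite -(ler_pM2l sD); lra.
(* Now the bound reads [N r l <= K r^2 / 2] for all [r >= 0]; taking [r = e / (K + 1)] gives
   [N l <= e]. *)
have s00 : s = 0 by lra.
have D00 : D = 0 by lra.
rewrite s00 D00 !mulr0 addr0 mulr0; apply/ler_addgt0Pr => e e0; rewrite add0r.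
have K1 : 0 < K + 1 by rewrite ltr_wpDl.
have := keyr (e / (K + 1)); rewrite s00 D00 expr0n/= mulr0 !add0r.
have ek : 0 < e / (K + 1) by rewrite divr_gt0.
move=> /(_ (ltW ek)); rewrite expr2 => H.
have : K * (e / (K + 1)) <= e by rewrite mulrCA ger_pMr// ler_pdivrMr//; lra.
rewrite -(ler_pM2l ek) => H2; rewrite -(ler_pM2l ek); move: H H2; nra.
Qed.

End PrimalDual.

(** * Transfer of norms, convexity and gradients from blocks to the product *)

Section Blocks.
Context {R : realType} {m d : nat}.
Implicit Types (x y : 'cV[R]_(m * d)) (i : 'I_m).

Lemma blockD x y i : block (x + y) i = block x i + block y i.
Proof. by apply/colP => k; rewrite !mxE. Qed.

Lemma blockZ (a : R) x i : block (a *: x) i = a *: block x i.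
Proof. by apply/colP => k; rewrite !mxE. Qed.

Lemma blockB x y i : block (x - y) i = block x i - block y i.
Proof. by apply/colP => k; rewrite !mxE. Qed.

Definition stack (z : 'I_m -> 'cV[R]_d) : 'cV[R]_(m * d) :=
  \col_j z (mxtens_unindex j).1 (mxtens_unindex j).2 0.

Lemma block_stack z i : block (stack z) i = z i.
Proof. by apply/colP => k; rewrite !mxE mxtens_indexK. Qed.

Lemma block_inj x y : (forall i, block x i = block y i) -> x = y.
Proof.
move=> xy; apply/colP => j; case: (mxtens_indexP j) => i k.
by have /colP/(_ k) := xy i; rewrite !mxE.
Qed.

Lemma dot_block x y : dot x y = \sum_i dot (block x i) (block y i).
Proof.
rewrite /dot pair_big/= (reindex (@mxtens_index m d))/=.
  by apply: eq_bigr => -[i k] _; rewrite !mxE.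
by exists (@mxtens_unindex m d) => ? _;
  rewrite (mxtens_indexK, mxtens_unindexK).
Qed.

Lemma enorm_block_le x i : enorm (block x i) <= enorm x.
Proof.
rewrite ler_wsqrtr// dot_block (bigD1 i)//= lerDl.
by apply: sumr_ge0 => j _; exact: dot_ge0.
Qed.

Lemma block_continuous i : continuous (fun x => block x i).
Proof.
move=> x; apply/(@cvgrPdist_le _ _ _ (nbhs x) (nbhs_filter x)) => e e0.
apply/nbhs_ballP; exists e => //= y [_ xy].
rewrite -blockB [leLHS]/Num.norm/= mx_normrE; apply/bigmax_leP; split.
  exact: ltW.
by move=> [k l] _ /=; rewrite !mxE; apply/ltW; exact: xy.
Qed.

(** The primal norm is the Euclidean norm of the vector of block norms, so the triangle inequality
    follows from those of the blocks, monotonicity and [enormD]. *)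
Lemma primal_norm_is_norm (nrm : 'I_m -> 'cV[R]_d -> R) :
  (forall i, is_norm (nrm i)) -> is_norm (primal_norm nrm).
Proof.
move=> nrmP.
have nD i u v : nrm i (u + v) <= nrm i u + nrm i v by have [] := nrmP i.
have nZ i a u : nrm i (a *: u) = `|a| * nrm i u by have [] := nrmP i.
have n0 i u : nrm i u = 0 -> u = 0 by have [_ _] := nrmP i; exact.
have n_ge0 i u : 0 <= nrm i u.
  have := nD i u (- u); rewrite subrr -scaleN1r nZ normrN1 mul1r.
  by rewrite -(scale0r 0) nZ normr0 mul0r; lra.
have pE x : primal_norm nrm x = enorm (\col_i nrm i (block x i)).
  by congr Num.sqrt; apply: eq_bigr => i _; rewrite !mxE.
split.
- move=> x y; rewrite !pE; apply: le_trans (enormD _ _).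
  rewrite ler_wsqrtr//; apply: ler_sum => i _; rewrite !mxE.
  by rewrite ler_pM// blockD.
- move=> a x; rewrite !pE -[`|a|]normr_id -enormZ; congr enorm; apply/colP => i.
  by rewrite !mxE blockZ nZ.
- move=> x; rewrite pE => nx0; apply: block_inj => i.
  rewrite -[0 in RHS](subrr x) blockB subrr; apply: (n0 i).
  have := sqr_enorm (\col_i nrm i (block x i)).
  rewrite nx0 expr0n => /esym/dot_eq0/colP/(_ i).
  by rewrite !mxE.
Qed.

Lemma prodset_convex (X : 'I_m -> set 'cV[R]_d) :
  (forall i, convex_set (X i)) -> convex_set (prodset X).
Proof.
move=> cX x y t; rewrite !inE => Xx Xy i.
have := cX i (block x i) (block y i) t; rewrite !inE => /(_ (Xx i) (Xy i)).
by rewrite /conv/= blockD !blockZ.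
Qed.

Lemma sumobj_convex (X : 'I_m -> set 'cV[R]_d) (f : 'I_m -> 'cV[R]_d -> R) :
  (forall i, convex_function (X i) (f i)) ->
  convex_function (prodset X) (sumobj f).
Proof.
move=> cf t x y; rewrite !inE => Xx Xy.
rewrite convRE /sumobj !mulr_sumr -big_split/=; apply: ler_sum => i _.
have := cf i t (block x i) (block y i); rewrite !inE => /(_ (Xx i) (Xy i)).
by rewrite convRE /conv/= blockD !blockZ.
Qed.

Lemma sumobj_gradient_within (X : 'I_m -> set 'cV[R]_d)
    (phi : 'I_m -> 'cV[R]_d -> R) (g : 'I_m -> 'cV[R]_d) x :
  (forall i, gradient_within (X i) (phi i) (block x i) (g i)) ->
  gradient_within (prodset X) (sumobj phi) x (stack g).
Proof.
(* Each of the [m] blocks gets tolerance [e / m.+1%:R]; the successor keeps the divisor positive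
   when [m = 0]. *)
move=> dphi e e0; have m0 : 0 < m.+1%:R :> R by [].
have : \forall u \near x, forall i, X i (block u i) ->
    `|phi i (block u i) - phi i (block x i) - dot (g i) (block u i - block x i)|
    <= e / m.+1%:R * enorm (block u i - block x i).
  apply: (filter_forall (nbhs_filter x)) => i.
  exact: (@block_continuous i x _ (dphi i _ (divr_gt0 e0 m0))).
rewrite near_withinE; apply: filterS => u Hu Xu.
rewrite /sumobj dot_block -!sumrB (le_trans (ler_norm_sum _ _ _))//.
apply: (@le_trans _ _ (\sum_(i < m) e / m.+1%:R * enorm (u - x))).
  apply: ler_sum => i _; rewrite block_stack blockB (le_trans (Hu i (Xu i)))//.
  by rewrite ler_pM2l ?divr_gt0// -blockB enorm_block_le.
rewrite sumr_const card_ord -[_ *+ m]mulr_natl mulrA ler_wpM2r ?enorm_ge0//.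
by rewrite mulrCA ger_pMr// ler_pdivrMr// mul1r ler_nat.
Qed.

(** This recasts the separable distance as that of a single prox-function, as the abstract analysis
    requires. *)
Lemma bregman_sumE (omega : 'I_m -> 'cV[R]_d -> R)
    (grad : 'I_m -> 'cV[R]_d -> 'cV[R]_d) :
  bregman_sum omega grad =
  bregman (sumobj omega) (fun x => stack (fun i => grad i (block x i))).
Proof.
apply/funext => x; apply/funext => u.
rewrite /bregman /sumobj dot_block -!sumrB; apply: eq_bigr => i _.
by rewrite block_stack blockB.
Qed.

End Blocks.

(** * Symmetry of the block Laplacian and assembly of the theorem *)

Lemma blaplacian_sym (R : realType) (m d : nat) (E : rel 'I_m) :
  symmetric E -> (blaplacian R d E)^T = blaplacian R d E.
Proof.
move=> Esym; rewrite trmx_tens trmx1; congr tensmx.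
apply/matrixP => i j; rewrite !mxE eq_sym Esym.
by case: eqP => // ->.
Qed.

Theorem theorem1 (R : realType) (m d : nat) (hm : (2 <= m)%N) (hd : (1 <= d)%N)
  (E : rel 'I_m) (hEsym : symmetric E) (hEconn : forall i j, connect E i j)
  (X : 'I_m -> set 'cV[R]_d)
  (hXclosed : forall i, closed (X i)) (hXconvex : forall i, convex_set (X i))
  (hXcap : exists z, forall i, X i z)
  (nrm : 'I_m -> 'cV[R]_d -> R) (hnrm : forall i, is_norm (nrm i))
  (f : 'I_m -> 'cV[R]_d -> R) (f' : 'I_m -> 'cV[R]_d -> 'cV[R]_d) (M : R)
  (hM : 0 <= M)
  (hfconvex : forall i, convex_function (X i) (f i))
  (hfsubgrad : forall i y, X i y -> subdifferential (X i) (f i) y (f' i y))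
  (hfM : forall i x y, X i x -> X i y ->
     0 <= f i x - f i y - dot (f' i y) (x - y) <= M * nrm i (x - y))
  (omega : 'I_m -> 'cV[R]_d -> R) (gomega : 'I_m -> 'cV[R]_d -> 'cV[R]_d)
  (homegaC1 : forall i,
     continuously_differentiable_on (X i) (omega i) (gomega i))
  (homega : forall i x u, X i x -> X i u ->
     nrm i (x - u) ^+ 2 <= dot (gomega i x - gomega i u) (x - u))
  (xs ys : 'cV[R]_(m * d))
  (hxs : optimal_P (blaplacian R d E) (prodset X) (sumobj f) xs)
  (hsaddle : saddle_SP (blaplacian R d E) (prodset X) (sumobj f) xs ys)
  (N : nat) (hN : (1 <= N)%N)
  (alpha tau eta : nat -> R)
  (halpha : forall k, (1 <= k <= N)%N -> alpha k = 1)
  (heta : forall k, (1 <= k <= N)%N ->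
     eta k = 2 * opnorm (primal_norm nrm) (blaplacian R d E))
  (htau : forall k, (1 <= k <= N)%N ->
     tau k = opnorm (primal_norm nrm) (blaplacian R d E))
  (x y : nat -> 'cV[R]_(m * d))
  (hiter : primal_dual_iterates (blaplacian R d E) (prodset X) (sumobj f)
     (bregman_sum omega gomega) alpha tau eta N x y) :
  let L := blaplacian R d E in
  let normL := opnorm (primal_norm nrm) L in
  let F := sumobj f in
  let V := bregman_sum omega gomega in
  let xbar := N%:R^-1 *: \sum_(1 <= k < N.+1) x k in
  F xbar - F xs <=
    normL / N%:R * (2 * V (x 0%N) xs + 2^-1 * enorm (y 0%N) ^+ 2)
  /\
  enorm (L *m xbar) <=
    2 * normL / N%:R *
      (3 * Num.sqrt (V (x 0%N) xs) + 2 * enorm (ys - y 0%N)).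
Proof.
move=> L normL F V xbar.
have pP : is_norm (primal_norm nrm) := primal_norm_is_norm nrm hnrm.
have [K0 LK] := enorm_mulmx_le_opnorm L pP.
have cX : convex_set (prodset X) := prodset_convex X hXconvex.
pose G (z : 'cV[R]_(m * d)) := stack (fun i => gomega i (block z i)).
have VE : V = bregman (sumobj omega) G := bregman_sumE omega gomega.
have dOm u : prodset X u -> gradient_within (prodset X) (sumobj omega) u (G u).
  move=> Xu; apply: sumobj_gradient_within => i.
  by have [dw _] := homegaC1 i; exact: dw.
have V_ge u v : prodset X u -> prodset X v ->
    primal_norm nrm (v - u) ^+ 2 / 2 <= bregman (sumobj omega) G u v.
  (* Strong convexity is derived directly on the product, where the blockwise monotonicity
     inequalities simply add up. *)
  move=> Xu Xv; apply: (@bregman_strongly_convex _ _ (prodset X)) => //.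
    move=> y1 y2 X1 X2; rewrite sqr_sqrtr; last first.
      by apply: sumr_ge0 => i _; exact: sqr_ge0.
    rewrite dot_block; apply: ler_sum => i _.
    by rewrite !blockB !block_stack; exact: homega.
  by case: pP.
have [Lxs _] := hxs.1.
rewrite VE.
apply: (primal_dual_rate L (prodset X) F _ G _ normL
  (blaplacian_sym R m d E hEsym) cX (sumobj_convex X f hfconvex)
  dOm V_ge K0 LK N x y alpha tau eta
  halpha htau heta _ xs ys hN hsaddle Lxs).
by rewrite -VE; exact: hiter.
Qed.
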